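(* Let $a,b\in(0,\infty)$, $p\geq1$, and let $\mu_n$ ($n\in\mathbb{N}$) and $\mu$ be in $\mathcal{M}$. Then $W^{a,b}_p(\mu_n,\mu)\to0$ if and only if $\mu_n\rightharpoonup\mu$ weakly and the family $\{\mu_n\}$ is tight.
   Context: $\mathcal{M}$ is the space of positive Borel measures with finite mass on $\mathbb{R}^d$; $|\mu|$ is total variation. Weak convergence $\mu_n\rightharpoonup\mu$ means $\int f\,d\mu_n\to\int f\,d\mu$ for every continuous compactly supported $f$. A set of measures $S$ is tight if for every $\varepsilon>0$ there is a compact $K_\varepsilon$ with $m(\mathbb{R}^d\setminus K_\varepsilon)<\varepsilon$ for all $m\in S$. For $\mu,\nu$ with finite $p$-th moments and $|\mu|=|\nu|>0$, $W_p(\mu,\nu):=(|\mu|\min_\pi\int|x-y|^pd\pi(x,y))^{1/p}$, the minimum over probability measures $\pi$ on $\mathbb{R}^d\times\mathbb{R}^d$ with marginals $\mu/|\mu|$ and $\nu/|\nu|$; $W_p(0,0)=0$. $W^{a,b}_p(\mu,\nu):=\inf\{a|\mu-\tilde\mu|+a|\nu-\tilde\nu|+bW_p(\tilde\mu,\tilde\nu)\}$ over $\tilde\mu,\tilde\nu\in\mathcal{M}$ with finite $p$-th moments and $|\tilde\mu|=|\tilde\nu|$. *)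

(* Defs.v *)
From HB Require Import structures.
From mathcomp Require Import all_boot all_order all_algebra.
From mathcomp Require Import all_classical all_reals all_analysis.
Set Implicit Arguments. Unset Strict Implicit. Unset Printing Implicit Defensive.
Import Order.TTheory GRing.Theory Num.Theory.
Import numFieldNormedType.Exports.
Local Open Scope classical_set_scope.
Local Open Scope ring_scope.

Definition Rd (R : realType) (d : nat) : measurableType _ :=
  g_sigma_algebraType (@open 'rV[R]_d).

Definition eucl (R : realType) (d : nat) (x : 'rV[R]_d) : R :=
  Num.sqrt (\sum_(i < d) (x ord0 i) ^+ 2).

Notation MM R d := ({finite_measure set (Rd R d) -> \bar R}).

Definition mass (R : realType) d (mu : MM R d) : \bar R := mu setT.

Definition finite_moment (R : realType) d (p : R) (mu : MM R d) : Prop :=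
  (\int[mu]_x ((eucl (x : 'rV[R]_d)) `^ p)%:E < +oo)%E.

Definition tv (R : realType) d (mu nu : MM R d) : \bar R :=
  ereal_sup [set s | exists (n : nat) (A : nat -> set (Rd R d)),
     (forall i, measurable (A i)) /\
     (forall i j, i <> j -> A i `&` A j = set0) /\
     s = (\sum_(i < n) `| mu (A i) - nu (A i) |)%E].

Definition normalized_coupling (R : realType) d (mu nu : MM R d)
    (pi : probability (Rd R d * Rd R d)%type R) : Prop :=
  (forall A : set (Rd R d), measurable A ->
     pi (A `*` setT) = (fine (mu A) / fine (mu setT))%:E) /\
  (forall B : set (Rd R d), measurable B ->
     pi (setT `*` B) = (fine (nu B) / fine (nu setT))%:E).

Definition Wp (R : realType) d (p : R) (mu nu : MM R d) : \bar R :=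
  if mass mu == 0%E then 0%E else
  poweR (mass mu * ereal_inf [set (\int[pi]_z ((eucl ((z.1 : 'rV[R]_d) - z.2))
                                                  `^ p)%:E)%E
                              | pi in normalized_coupling mu nu])%E (p^-1).

Definition Wab (R : realType) d (a b p : R) (mu nu : MM R d) : \bar R :=
  ereal_inf [set s | exists mt nt : MM R d,
     finite_moment p mt /\ finite_moment p nt /\ mass mt = mass nt /\
     s = (a%:E * tv mu mt + a%:E * tv nu nt + b%:E * Wp p mt nt)%E].

Definition Cc (R : realType) d (f : 'rV[R]_d -> R) : Prop :=
  continuous f /\ exists K : set 'rV[R]_d, compact K /\ forall x, ~ K x -> f x = 0.

Definition weak_cvg (R : realType) d (mu_ : nat -> MM R d) (mu : MM R d) : Prop :=
  forall f : 'rV[R]_d -> R, Cc f ->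
    (fun n => \int[mu_ n]_x (f x)%:E)%E @ \oo --> (\int[mu]_x (f x)%:E)%E.

Definition tight (R : realType) d (mu_ : nat -> MM R d) : Prop :=
  forall eps : R, 0 < eps -> exists K : set 'rV[R]_d, compact K /\
    forall n, (mu_ n (~` K : set (Rd R d)) < eps%:E)%E.

(* Main.v *)
Require Import Defs.
From HB Require Import structures.
From mathcomp Require Import all_boot all_order all_algebra.
From mathcomp Require Import all_classical all_reals all_analysis.
From mathcomp Require Import measurable_realfun ring lra.
Import Order.TTheory GRing.Theory Num.Def Num.Theory.
Import numFieldNormedType.Exports.
Local Open Scope classical_set_scope.
Local Open Scope ring_scope.

(** If [W^{a,b}_p(mu_n, mu)] is small, there are equal-mass measures [mt, nt] close
    to [mu_n, mu] in total variation and to each other in [W_p]. When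
    [f x <= g y + eta + L |x - y|^p] with [f, g] valued in [[0, M]], integrating
    against a near-optimal coupling of [mt, nt] gives [int f dmu_n <= int g dmu]
    up to a small error. For [f = g] continuous with compact support (such an [L]
    exists for each [eta > 0] by uniform continuity) this is weak convergence; for
    [f, g] the indicators of [|x| > s + 1] and [|x| > s] it is tightness.

    Conversely, take a partition of unity [phi_i] with small supports that sums to
    [1] on a large ball, and put [c_i = min (int phi_i dmu_n) (int phi_i dmu)].
    Rescaling each [phi_i mu_n] and [phi_i mu] to mass [c_i] and coupling them by a
    product measure inside each cell bounds [W^{a,b}_p] by the masses left over and
    the diameter of the cells. Weak convergence is only needed for the finitely
    many [phi_i]. *)

(** * Topology and measurability in the Euclidean space *)

Lemma continuous_sum (R : realType) (T : topologicalType) (I : Type) (r : seq I) (g : I -> T -> R) :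
  (forall i, continuous (g i)) -> continuous (fun x => \sum_(i <- r) g i x).
Proof.
move=> cg; elim: r => [|i r IH] x.
  by under eq_fun do rewrite big_nil; exact: cvg_cst.
under eq_fun do rewrite big_cons.
by apply: cvgD; [exact: cg|exact: IH].
Qed.

Lemma dist_continuous (R : realType) (V : normedModType R) (c : V) :
  continuous (fun x => `|c - x|).
Proof.
by move=> x; apply: cvg_norm; apply: cvgB; [exact: cvg_cst|exact: cvg_id].
Qed.

Section euclidean_space.
Context {R : realType} {d : nat}.
Implicit Types (x y : 'rV[R]_d) (f : 'rV[R]_d -> R) (K : set 'rV[R]_d).

Lemma eucl_ge0 x : 0 <= eucl x.
Proof. exact: sqrtr_ge0. Qed.

Lemma coord_le_norm x i : `|x ord0 i| <= `|x|.
Proof.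
rewrite [leRHS]/normr /= mx_normrE; apply/bigmax_geP; right => /=.
by exists (ord0, i).
Qed.

Lemma norm_le_eucl x : `|x| <= eucl x.
Proof.
rewrite [leLHS]/normr /= mx_normrE; apply/bigmax_leP; split; first exact: eucl_ge0.
move=> [j i] _ /=; rewrite (ord1 j) -sqrtr_sqr ler_wsqrtr//.
by rewrite (bigD1 i)//= lerDl sumr_ge0// => k _; exact: sqr_ge0.
Qed.

(** [|x|] is the largest absolute coordinate, so the sum of squares is at most [d * |x|^2], and
    [d <= d^2] gives the crude constant [d]. *)
Lemma eucl_le_norm x : eucl x <= d%:R * `|x|.
Proof.
rewrite -[leRHS]ger0_norm ?mulr_ge0// -sqrtr_sqr ler_wsqrtr//.
have -> : (d%:R * `|x|) ^+ 2 = \sum_(i < d) d%:R * `|x| ^+ 2.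
  by rewrite sumr_const card_ord -mulr_natr; ring.
apply: ler_sum => i _; rewrite -real_normK ?num_real//.
have d1 : 1 <= d%:R :> R by rewrite ler1n; case: (d) i => // -[].
apply: (@le_trans _ _ (`|x| ^+ 2)).
  by rewrite lerXn2r ?nnegrE// coord_le_norm.
by rewrite ler_peMl// sqr_ge0.
Qed.

Lemma open_measurable_Rd (A : set 'rV[R]_d) :
  open A -> measurable (A : set (Rd R d)).
Proof. by move=> oA; apply: sub_gen_smallest. Qed.

Lemma closed_measurable_Rd (A : set 'rV[R]_d) :
  closed A -> measurable (A : set (Rd R d)).
Proof.
by move=> cA; rewrite -[A]setCK; apply: measurableC; apply: open_measurable_Rd; rewrite openC.
Qed.

Lemma continuous_measurable_Rd f : continuous f ->
  measurable_fun setT (f : Rd R d -> R).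
Proof.
move=> cf; apply: (measurability _ (RGenOpens.measurableE R)).
move=> _ [_ [a [b ->]] <-]; rewrite setTI.
apply: open_measurable_Rd; move/continuousP : cf; apply.
exact: interval_open.
Qed.

Lemma measurable_coord i : measurable_fun setT (fun x : Rd R d => (x : 'rV[R]_d) ord0 i).
Proof. by apply: continuous_measurable_Rd; exact: coord_continuous. Qed.

(** Working coordinate by coordinate suits maps out of [Rd R d * Rd R d]: the projections suffice,
    without comparing the product sigma-algebra with the Borel one. *)
Lemma measurable_eucl d' (T : measurableType d') (g : T -> 'rV[R]_d) :
  (forall i, measurable_fun setT (fun t => g t ord0 i)) ->
  measurable_fun setT (fun t => eucl (g t)).
Proof.
move=> mg; apply: (@measurableT_comp _ _ _ _ _ _ (@Num.sqrt R)).
  by apply: continuous_measurable_fun; exact: sqrt_continuous.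
apply: measurable_sum => i; exact: measurable_funX.
Qed.

Lemma measurable_cost p :
  measurable_fun setT (fun z : Rd R d * Rd R d =>
    ((eucl ((z.1 : 'rV[R]_d) - z.2)) `^ p)%:E).
Proof.
apply/measurable_EFinP; apply: (measurableT_comp (measurable_powR p)).
apply: measurable_eucl => i.
rewrite (_ : (fun _ => _) = fun z : Rd R d * Rd R d =>
    (z.1 : 'rV[R]_d) ord0 i - (z.2 : 'rV[R]_d) ord0 i); last first.
  by apply/funext => z; rewrite !mxE.
apply: measurable_funB.
- exact: (measurableT_comp (measurable_coord i) measurable_fst).
- exact: (measurableT_comp (measurable_coord i) measurable_snd).
Qed.

Lemma Cc_bounded f : Cc f -> exists2 M, 0 <= M & forall x, `|f x| <= M.
Proof.
move=> [cf [K [cK K0]]].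
have /compact_bounded[B [_ fB]] : compact (f @` K).
  by apply: continuous_compact => //; exact: continuous_subspaceT.
exists (`|B| + 1); first by rewrite addr_ge0.
move=> x; have [Kx|nKx] := pselect (K x); last by rewrite K0// normr0 addr_ge0.
by apply: fB; [rewrite (le_lt_trans (ler_norm _))// ltrDl|exists x].
Qed.

(** Compactness of [K] gives one radius valid for all [x] in [K] and arbitrary [y]. Pairs meeting
    [K] are covered up to symmetry; for the others both values are zero. *)
Lemma Cc_unif_continuous f : Cc f -> forall e, 0 < e ->
  exists2 r, 0 < r & forall x y, `|x - y| < r -> `|f x - f y| < e.
Proof.
move=> [cf [K [cK K0]]] e e0.
have : \forall r \near 0^'+, K `<=` (fun x => forall y, `|x - y| < r -> `|f x - f y| < e).
  apply: ((compact_near_coveringP K).1 cK) => x Kx.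
  have e20 : 0 < e / 2 by rewrite divr_gt0.
  have /cvgr_dist_lt/(_ _ e20)/nbhs_ballP[s /= s0 fs] := cf x.
  exists (ball x (s / 2), [set r | r < s / 2]) => /=.
    by split; [apply: nbhsx_ballx; rewrite divr_gt0|apply: nbhs_right_lt; rewrite divr_gt0].
  move=> [z r] /= [+ rs] y zy; rewrite -ball_normE /= => xz.
  have fz : `|f x - f z| < e / 2.
    by apply: fs; rewrite -ball_normE /=; apply: lt_le_trans xz _; lra.
  have fy : `|f x - f y| < e / 2.
    apply: fs; rewrite -ball_normE /= (splitr s) -(subrKA z).
    by rewrite (le_lt_trans (ler_normD _ _))// ltrD// (lt_trans zy).
  by rewrite (splitr e) -(subrKA (f x)) (le_lt_trans (ler_normD _ _))// ltrD// distrC.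
move=> /(filterI (nbhs_right_gt 0))/(@filter_ex _ _ _)[r /= [r0 Kr]].
exists r => // x y xy.
have [/Kr|nKx] := pselect (K x); first exact.
have [/Kr/(_ x)|nKy] := pselect (K y).
  by rewrite distrC [`|f x - _|]distrC; apply.
by rewrite !K0// subrr normr0.
Qed.

(** Tents [psi i] of radius [r] around the centres of a finite cover by balls of radius [r / 2] are
    divided by [M = max (r / 2) S], where [S] is their sum. This [M] is positive and continuous
    everywhere, and on [K] some tent is at least [r / 2], so that [M = S] there. *)
Lemma partition_of_unity K (r : R) : compact K -> 0 < r ->
  exists (N : nat) (phi : 'I_N -> 'rV[R]_d -> R),
    [/\ forall i, Cc (phi i),
        forall i x, 0 <= phi i x,
        forall x, \sum_i phi i x <= 1,
        forall x, K x -> \sum_i phi i x = 1 &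
        forall i, exists c, forall x, phi i x != 0 -> `|c - x| <= r].
Proof.
move=> cK r0.
have r20 : 0 < r / 2 by rewrite divr_gt0.
have [D _ KD] : finite_subset_cover setT (fun c : 'rV[R]_d => ball c (r / 2)) K.
  move: cK; rewrite compact_cover; apply.
    by move=> c _; exact: ball_open.
  by move=> x Kx; exists x => //; exact: ballxx.
pose s := finmap.enum_fset D.
pose c (i : 'I_(size s)) := nth 0 s i.
pose psi i x : R := Num.max 0 (r - `|c i - x|).
pose S x := \sum_i psi i x.
pose M x := Num.max (r / 2) (S x).
have psi0 i x : 0 <= psi i x by rewrite /psi le_max lexx.
have cpsi i : continuous (psi i).
  move=> x; apply: (@continuous_max _ _ (fun=> 0) (fun x => r - `|c i - x|)).
    exact: cst_continuous.
  apply: (@continuousB _ R^o _ (fun=> r) (fun x => `|c i - x|)).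
    exact: cst_continuous.
  exact: dist_continuous.
have cM : continuous M.
  move=> x; apply: (@continuous_max _ _ (fun=> r / 2) S); first exact: cst_continuous.
  exact: continuous_sum.
have M0 x : 0 < M x by rewrite /M lt_max r20.
have supp i x : psi i x / M x != 0 -> `|c i - x| <= r.
  apply: contraNle => ri; rewrite /psi max_l ?mul0r//.
  by rewrite subr_le0 ltW.
exists (size s), (fun i x => psi i x / M x); split => //.
- move=> i; split.
    move=> x; apply: (@continuousM _ _ (psi i) (fun y => (M y)^-1)).
      exact: cpsi.
    by apply: continuousV; [rewrite gt_eqF|exact: cM].
  exists (closed_ball (c i) r); split.
    apply: bounded_closed_compact; last exact: closed_ball_closed.
    exists (`|c i| + r); split; first exact: num_real.
    move=> u cu x; rewrite closed_ballE// /closed_ball_ /= => xr.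
    rewrite -(subrK (c i) x) (le_trans (ler_normD _ _))// distrC.
    by rewrite addrC (le_trans _ (ltW cu))// lerD2l.
  move=> x; rewrite closed_ballE// /closed_ball_ /=.
  by apply: contra_notP => /eqP; exact: supp.
- by move=> i x; rewrite divr_ge0// ltW.
- by move=> x; rewrite -mulr_suml ler_pdivrMr// mul1r le_max lexx orbT.
- move=> x Kx; rewrite -mulr_suml -/(S x).
  have rS : r / 2 <= S x.
    have [e De] := KD x Kx; rewrite -ball_normE /= => ex.
    have es : (index e s < size s)%N by rewrite index_mem.
    rewrite /S (bigD1 (Ordinal es))//= (@le_trans _ _ (psi (Ordinal es) x))//.
      rewrite /psi le_max /c nth_index//; apply/orP; right; lra.
    by rewrite lerDl sumr_ge0.
  by rewrite /M max_r// divff// gt_eqF// (lt_le_trans r20).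
- by move=> i; exists (c i); exact: supp.
Qed.

End euclidean_space.

(** * Densities and total variation *)

Section density.
Local Open Scope ereal_scope.
Context d (T : measurableType d) (R : realType).
Variables (mu : {measure set T -> \bar R}) (f : T -> R).
Hypothesis f0 : forall x, (0 <= f x)%R.
Hypothesis mf : measurable_fun setT f.

(* The proofs are arguments so that the measure structure can be inferred. *)
Definition density of (forall x, (0 <= f x)%R) & measurable_fun setT f :=
  fun A => \int[mu]_(x in A) (f x)%:E.

Local Notation nu := (density f0 mf).

Let density0 : nu set0 = 0.
Proof. by rewrite /density integral_set0. Qed.

Let density_ge0 A : 0 <= nu A.
Proof. by apply: integral_ge0 => x _; rewrite lee_fin. Qed.

Let density_sigma_additive : semi_sigma_additive nu.
Proof.
move=> /= F mF tF mUF; rewrite /density; apply: cvg_toP.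
  apply: ereal_nondecreasing_is_cvgn => m n mn.
  by apply: lee_sum_nneg_natr => // k _ _; exact: density_ge0.
rewrite ge0_integral_bigcup//=.
- by apply: measurable_funTS; exact/measurable_EFinP.
- by move=> x _; rewrite lee_fin.
Qed.

HB.instance Definition _ := isMeasure.Build _ _ _ nu
  density0 density_ge0 density_sigma_additive.

Lemma density_eq0 A : measurable A -> (forall x, A x -> f x = 0%R) -> nu A = 0.
Proof.
by move=> mA fA; rewrite /density integral0_eq// => x Ax; rewrite fA.
Qed.

End density.
Arguments density {d T R} mu {f}.

Section tv.
Import HBNNSimple.
Local Open Scope ereal_scope.
Context {R : realType} {d : nat}.
Implicit Types (mu nu : MM R d) (f : Rd R d -> R).

Lemma tvC mu nu : tv mu nu = tv nu mu.
Proof.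
congr ereal_sup; apply/seteqP; split=> _ [n [A [mA [tA ->]]]];
  exists n, A; split=> //; split=> //; apply: eq_bigr => i _;
  by rewrite -abseN fin_num_oppeB ?fin_num_measure// addeC.
Qed.

Lemma tv_ge0 mu nu : 0 <= tv mu nu.
Proof.
apply: ereal_sup_ubound; exists 0%N, (fun=> set0); split=> //; split=> //.
  by move=> i j _; rewrite setI0.
by rewrite big_ord0.
Qed.

(** For a simple [h <= f], replacing [mu] by [nu] on a level set costs at most [M] times the
    discrepancy of the two measures there. The level sets are finitely many and disjoint, so [tv]
    bounds the sum; then take the supremum over [h]. *)
Lemma le_integral_tv mu nu f (M : R) : measurable_fun setT f ->
  (forall x, (0 <= f x)%R) -> (forall x, (f x <= M)%R) ->
  \int[mu]_x (f x)%:E <= \int[nu]_x (f x)%:E + M%:E * tv mu nu.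
Proof.
move=> mf f0 fM.
have M0 : (0 <= M)%R := le_trans (f0 0%R) (fM 0%R).
rewrite ge0_integralTE; last by move=> x; rewrite lee_fin.
apply: ge_ereal_sup => _ [h hf <-].
pose s := finmap.enum_fset (fset_set (range h)).
have fr : finite_set (range h) by exact: fimfunP.
have us : uniq s by exact: finmap.fset_uniq.
have sM r : r \in s -> (0 <= r <= M)%R.
  rewrite in_fset_set// inE => -[x _ <-]; rewrite fun_ge0/=.
  by rewrite (le_trans _ (fM x))// -lee_fin hf.
have sE (m : MM R d) : sintegral m h = \sum_(r <- s) r%:E * m (h @^-1` [set r]).
  by rewrite sintegralE fsbig_finite.
have hnu : sintegral nu h <= \int[nu]_x (f x)%:E.
  by rewrite ge0_integralTE; [apply: ereal_sup_ubound; exists h|move=> x; rewrite lee_fin].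
apply: (@le_trans _ _ (sintegral nu h +
    \sum_(r <- s) M%:E * `|mu (h @^-1` [set r]) - nu (h @^-1` [set r])|)).
  rewrite !sE -big_split/= big_seq [leRHS]big_seq; apply: lee_sum => r rs.
  have /andP[r0 rM] := sM r rs.
  apply: (@le_trans _ _ (r%:E * nu (h @^-1` [set r]) +
     r%:E * `|mu (h @^-1` [set r]) - nu (h @^-1` [set r])|)); last first.
    by rewrite leeD2l// lee_wpmul2r// lee_fin.
  rewrite -ge0_muleDr// lee_wpmul2l ?lee_fin//.
  by rewrite -leeBlDl ?fin_num_measure// lee_abs.
apply: leeD => //; rewrite -ge0_sume_distrr// lee_wpmul2l ?lee_fin//.
rewrite (big_nth 0%R) big_mkord; apply: ereal_sup_ubound.
(* The families in [tv] are indexed by all of [nat], hence the padding with empty sets past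
   [size s]. *)
exists (size s), (fun i => if (i < size s)%N then h @^-1` [set nth 0%R s i] else set0).
split; first by move=> i; case: ifPn => // _; exact: measurable_sfunP.
split; last by apply: eq_bigr => i _; rewrite ltn_ord.
move=> i j ij; case: ifPn => [is_|_]; last by rewrite set0I.
case: ifPn => [js|_]; last by rewrite setI0.
apply/seteqP; split=> // x /= [-> /eqP]; rewrite nth_uniq// => /eqP.
exact: ij.
Qed.

(** Here [nu <= mu] setwise, so the absolute values drop and the sum is [mu B - nu B] for the union
    [B]. Adding the nonnegative difference on the complement gives the difference of the masses. *)
Lemma tv_density mu nu f (f0 : forall x, (0 <= f x)%R) (mf : measurable_fun setT f) :
  (forall x, (f x <= 1)%R) ->
  (forall A, measurable A -> nu A = density mu f0 mf A) ->
  tv mu nu <= mass mu - mass nu.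
Proof.
move=> f1 nuE; apply: ge_ereal_sup => _ [n [A [mA [tA ->]]]].
have nu_mu B : measurable B -> nu B <= mu B.
  move=> mB; rewrite nuE// /density -[leRHS]mul1e -integral_cst//.
  by apply: ge0_le_integral => //; [move=> x _; rewrite lee_fin|
    apply/measurable_EFinP; exact: measurable_funTS|move=> x _; rewrite lee_fin].
pose B := \big[setU/set0]_(i < n) A i.
have mB : measurable B by exact: bigsetU_measurable.
have mBC : measurable (~` B) by exact: measurableC.
have tA' : trivIset setT A.
  by apply/trivIsetP => i j _ _ /eqP/tA.
under eq_bigr do rewrite gee0_abs ?sube_ge0 ?nu_mu ?fin_num_measure//.
rewrite big_split/= fin_num_sumeN; last first.
  by move=> i _; rewrite fin_num_measure.
rewrite -!measure_semi_additive_ord_I//; [|exact: sub_trivIset tA'..].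
rewrite -/B /mass -(setvU B) setUC.
rewrite !measureU ?setICr// fin_num_oppeD ?fin_num_measure//.
by rewrite addeACA leeDl// sube_ge0 ?fin_num_measure// nu_mu.
Qed.

End tv.

(** * Couplings *)

Section coupling.
Local Open Scope ereal_scope.

(** A change of variables: [m] is [k] times the image of [P] under [phi]. The factor [k] will be a
    mass, since couplings are normalised while [mu] and [nu] are not. *)
Lemma ge0_integral_marginal d1 d2 (T1 : measurableType d1) (T2 : measurableType d2)
    (R : realType) (P : {measure set T1 -> \bar R}) (m : {measure set T2 -> \bar R})
    (phi : T1 -> T2) (k : R) (f : T2 -> \bar R) :
  measurable_fun setT phi -> (0 <= k)%R ->
  (forall A, measurable A -> m A = k%:E * P (phi @^-1` A)) ->
  measurable_fun setT f -> (forall x, 0 <= f x) ->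
  \int[m]_x f x = k%:E * \int[P]_x f (phi x).
Proof.
move=> mphi k0 mE mf f0.
have := @ge0_integral_pushforward _ _ _ _ _ phi mphi P setT f measurableT mf (fun x _ => f0 x).
rewrite preimage_setT => /= <-.
rewrite -(@ge0_integral_mscale _ _ _ _ _ measurableT (NngNum k0))//.
by apply: eq_measure_integral => A mA _; rewrite mE.
Qed.

Context {R : realType} {d : nat}.
Implicit Types (mu nu : MM R d) (f g : Rd R d -> R) (pi : probability (Rd R d * Rd R d)%type R).

Lemma coupling_integral1 mu nu pi (f : Rd R d -> \bar R) :
  normalized_coupling mu nu pi -> mass mu != 0 ->
  measurable_fun setT f -> (forall x, 0 <= f x) ->
  \int[mu]_x f x = mass mu * \int[pi]_z f z.1.
Proof.
move=> [pi1 _] m0 mf f0; rewrite -(@fineK _ (mass mu)) ?fin_num_measure//.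
apply: ge0_integral_marginal => //; first by rewrite fine_ge0.
move=> A mA; transitivity ((fine (mass mu))%:E * (fine (mu A) / fine (mass mu))%:E).
  rewrite -EFinM mulrCA divff ?mulr1 ?fineK ?fin_num_measure//.
  by rewrite fine_eq0 ?fin_num_measure.
congr (_ * _); rewrite -[LHS](pi1 A mA); congr (pi _).
by apply: funext => z; apply: propext; split => //= -[].
Qed.

Lemma coupling_integral2 mu nu pi (f : Rd R d -> \bar R) :
  normalized_coupling mu nu pi -> mass nu != 0 ->
  measurable_fun setT f -> (forall x, 0 <= f x) ->
  \int[nu]_x f x = mass nu * \int[pi]_z f z.2.
Proof.
move=> [_ pi1] m0 mf f0; rewrite -(@fineK _ (mass nu)) ?fin_num_measure//.
apply: ge0_integral_marginal => //; first by rewrite fine_ge0.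
move=> A mA; transitivity ((fine (mass nu))%:E * (fine (nu A) / fine (mass nu))%:E).
  rewrite -EFinM mulrCA divff ?mulr1 ?fineK ?fin_num_measure//.
  by rewrite fine_eq0 ?fin_num_measure.
congr (_ * _); rewrite -[LHS](pi1 A mA); congr (pi _).
by apply: funext => z; apply: propext; split => //= -[].
Qed.

Lemma integral_mass0 mu (f : Rd R d -> \bar R) :
  mass mu = 0 -> \int[mu]_x f x = 0.
Proof.
move=> mu0; rewrite (eq_measure_integral mzero) ?integral_measure_zero// => A mA _.
have : mu A <= mass mu by rewrite le_measure ?inE.
by rewrite mu0 => muA; apply/eqP; rewrite eq_le measure_ge0 andbT.
Qed.

Local Notation cost p z := (((eucl ((z.1 : 'rV[R]_d) - z.2)) `^ p)%:E).

(** Monotonicity of the power [p^-1] turns the hypothesis into a strict bound on the infimum, which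
    some coupling meets whether or not the infimum is attained. *)
Lemma Wp_lt_coupling (p e : R) mu nu : (0 < p)%R -> (0 < e)%R ->
  Wp p mu nu < e%:E -> mass mu != 0 ->
  exists2 pi, normalized_coupling mu nu pi &
    mass mu * \int[pi]_z cost p z < (e `^ p)%:E.
Proof.
move=> p0 e0; rewrite /Wp; case: ifPn => // mu0 We _.
have mugt0 : 0 < mass mu by rewrite lt_def mu0 measure_ge0.
have mufin : mass mu \is a fin_num by rewrite fin_num_measure.
set I := ereal_inf _ in We.
have I0 : 0 <= I.
  by apply: le_ereal_inf_tmp => _ [pi _ <-]; apply: integral_ge0 => z _; rewrite lee_fin powR_ge0.
have {}We : mass mu * I < (e `^ p)%:E.
  rewrite ltNge; apply/negP => h; move: We; rewrite ltNge => /negP; apply.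
  have : ((e `^ p)%:E `^ p^-1 <= (mass mu * I) `^ p^-1)%E.
    apply: gt0_ler_poweR => //; rewrite ?invr_ge0 ?(ltW p0)//.
      by rewrite in_itv/= leey lee_fin powR_ge0.
    by rewrite in_itv/= leey mule_ge0// ltW.
  by rewrite poweR_EFin -powRrM divff ?gt_eqF// powRr1// ltW.
have mugt0' : (0 < fine (mass mu))%R by rewrite fine_gt0// mugt0 ltey_eq mufin.
have : I < (fine (mass mu))^-1%:E * (e `^ p)%:E.
  by rewrite lte_pdivlMl// fineK.
move=> /ereal_inf_lt[_ [pi npi <-]]; rewrite lte_pdivlMl// fineK// => h.
by exists pi.
Qed.

Lemma le_integral_cost (pi : probability (Rd R d * Rd R d)%type R) (p eta L : R)
    (h k : Rd R d * Rd R d -> R) : (0 <= eta)%R -> (0 <= L)%R ->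
  measurable_fun setT h -> measurable_fun setT k ->
  (forall z, 0 <= h z)%R -> (forall z, 0 <= k z)%R ->
  (forall z, h z <= k z + eta + L * eucl ((z.1 : 'rV[R]_d) - z.2) `^ p)%R ->
  \int[pi]_z (h z)%:E <=
  \int[pi]_z (k z)%:E + eta%:E + L%:E * \int[pi]_z cost p z.
Proof.
move=> eta0 L0 mh mk h0 k0 hk.
have cost0 z : 0 <= cost p z by rewrite lee_fin powR_ge0.
have mc := @measurable_cost R d p.
have -> : eta%:E = \int[pi]_z (cst eta%:E) z.
  by rewrite integral_cst//= probability_setT mule1.
rewrite -ge0_integralZl//.
rewrite -ge0_integralD//; first last.
- exact/measurable_EFinP.
- by move=> z _; rewrite lee_fin.
rewrite -ge0_integralD//; first last.
- exact: measurable_funeM.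
- by move=> z _; rewrite mule_ge0.
- by apply/measurable_EFinP/measurable_funD.
- by move=> z _; rewrite -EFinD lee_fin addr_ge0.
apply: ge0_le_integral => //.
- by move=> z _; rewrite lee_fin.
- exact/measurable_EFinP.
- apply: emeasurable_funD; last exact: measurable_funeM.
  by apply/measurable_EFinP/measurable_funD.
- by move=> z _; rewrite -EFinM -!EFinD lee_fin.
Qed.

(** Under a coupling both integrals run over pairs, where the pointwise inequality applies; [eta] is
    paid once per unit of mass. The same coupling serves both directions. *)
Lemma Wp_integral_le (p e eta L : R) mu nu f g :
  (0 < p)%R -> (0 < e)%R -> (0 <= eta)%R -> (0 <= L)%R ->
  measurable_fun setT f -> measurable_fun setT g ->
  (forall x, 0 <= f x)%R -> (forall x, 0 <= g x)%R ->
  mass mu = mass nu -> Wp p mu nu < e%:E ->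
  ((forall x y, f x <= g y + eta + L * eucl ((x : 'rV[R]_d) - y) `^ p)%R ->
   \int[mu]_x (f x)%:E <= \int[nu]_x (g x)%:E + eta%:E * mass nu + (L * e `^ p)%:E) /\
  ((forall x y, g y <= f x + eta + L * eucl ((x : 'rV[R]_d) - y) `^ p)%R ->
   \int[nu]_x (g x)%:E <= \int[mu]_x (f x)%:E + eta%:E * mass nu + (L * e `^ p)%:E).
Proof.
move=> p0 e0 eta0 L0 mf mg f0 g0 mE We.
have Le0 : 0 <= (L * e `^ p)%:E by rewrite lee_fin mulr_ge0// powR_ge0.
(* Without mass [Wp] is zero by convention and provides no coupling, but both integrals vanish. *)
have [mu0|mu0] := eqVneq (mass mu) 0.
  by rewrite -mE mu0 mule0 !integral_mass0 -?mE// !add0e; split.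
have nu0 : mass nu != 0 by rewrite -mE.
have [pi npi Wpi] := Wp_lt_coupling _ _ _ _ p0 e0 We mu0.
have EF (F : Rd R d -> R) : measurable_fun setT F -> measurable_fun setT (EFin \o F).
  by move=> ?; exact/measurable_EFinP.
rewrite (coupling_integral1 _ _ _ (EFin \o f) npi)//; last exact: EF.
rewrite (coupling_integral2 _ _ _ (EFin \o g) npi)//; last exact: EF.
have key (h k : Rd R d * Rd R d -> R) :
    measurable_fun setT h -> measurable_fun setT k ->
    (forall z, 0 <= h z)%R -> (forall z, 0 <= k z)%R ->
    (forall z, h z <= k z + eta + L * eucl ((z.1 : 'rV[R]_d) - z.2) `^ p)%R ->
    mass mu * \int[pi]_z (h z)%:E <=
    mass mu * \int[pi]_z (k z)%:E + eta%:E * mass mu + (L * e `^ p)%:E.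
  move=> mh mk h0 k0 hk.
  have c0 : 0 <= \int[pi]_z cost p z.
    by apply: integral_ge0 => z _; rewrite lee_fin powR_ge0.
  have k0' : 0 <= \int[pi]_z (k z)%:E by apply: integral_ge0 => z _; rewrite lee_fin.
  have mu_ge0 : 0 <= mass mu by exact: measure_ge0.
  have := le_integral_cost pi p eta L h k eta0 L0 mh mk h0 k0 hk.
  move: c0 k0' Wpi; set C := \int[pi]_z cost p z; move: C (\int[pi]_z (k z)%:E).
  move=> C K C0 K0 Wpi hkC.
  apply: (@le_trans _ _ (mass mu * (K + eta%:E + L%:E * C))); first exact: lee_wpmul2l.
  rewrite !ge0_muleDr ?adde_ge0 ?mule_ge0 ?lee_fin//.
  apply: leeD; first by rewrite (muleC eta%:E).
  by rewrite muleCA EFinM lee_wpmul2l ?lee_fin// ltW.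
rewrite -mE; split=> fg; apply: key.
- exact: measurableT_comp.
- exact: measurableT_comp.
- by [].
- by [].
- by move=> z; exact: fg.
- exact: measurableT_comp.
- exact: measurableT_comp.
- by [].
- by [].
- by move=> z; exact: fg.
Qed.

End coupling.

(** * From the transport distance to weak convergence and tightness *)

Section extended_real_limits.
Context {R : realType}.
Local Open Scope ereal_scope.
Implicit Types (u : nat -> \bar R) (l : R).

Lemma cvg_EFin_near u l : u @ \oo --> l%:E ->
  forall e, (0 < e)%R -> \forall n \near \oo, u n \is a fin_num /\ (`|l - fine (u n)| < e)%R.
Proof.
move=> /fine_cvgP[ufin ul] e e0; near=> n; split; near: n => //.
exact: cvgr_dist_lt.
Unshelve. all: by end_near. Qed.

(** As [l] and [e] are finite, the two inequalities force [u n] to be finite, and the claim becomes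
    a limit of reals. *)
Lemma near_cvg_EFin u l :
  (forall e, (0 < e)%R -> \forall n \near \oo,
     u n <= l%:E + e%:E /\ l%:E <= u n + e%:E) ->
  u @ \oo --> l%:E.
Proof.
move=> ul; have ufin e n : u n <= l%:E + e%:E -> l%:E <= u n + e%:E -> u n \is a fin_num.
  by case: (u n).
apply/fine_cvgP; split.
  near=> n; have [] : u n <= l%:E + 1%:E /\ l%:E <= u n + 1%:E by near: n; exact: ul.
  exact: ufin.
apply/cvgrPdist_le => e e0; near=> n.
have [h1 h2] : u n <= l%:E + e%:E /\ l%:E <= u n + e%:E by near: n; exact: ul.
have un := fineK (ufin e n h1 h2); move: h1 h2; rewrite -un /=.
rewrite -!EFinD !lee_fin ler_distl => h1 h2; lra.
Unshelve. all: by end_near. Qed.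

End extended_real_limits.

(** * Tails of finite measures *)

Section radius.
Context {R : realType} {d : nat}.
Implicit Types (mu : MM R d).

Definition far (r : R) : set (Rd R d) := [set x | r < `|x : 'rV[R]_d|].

Lemma near_compact (r : R) : compact (~` far r : set 'rV[R]_d).
Proof.
apply: bounded_closed_compact.
  exists r; split; first exact: num_real.
  by move=> u ru x /= /negP; rewrite -leNgt => /le_trans; apply; exact: ltW.
rewrite (_ : ~` _ = normr @^-1` [set x | x <= r]).
  apply: closed_comp; last exact: closed_le.
  by move=> x _; exact: norm_continuous.
by apply/seteqP; split=> x /=; rewrite leNgt => /negP.
Qed.

Lemma measurable_far r : measurable (far r).
Proof.
rewrite -(setCK (far r)); apply: measurableC; apply: closed_measurable_Rd.
by apply: compact_closed; [exact: norm_hausdorff|exact: near_compact].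
Qed.

Lemma far_subset (r s : R) : r <= s -> far s `<=` far r.
Proof. by move=> rs x; exact: le_lt_trans. Qed.

Lemma compact_far (K : set 'rV[R]_d) : compact K -> exists r, far r `<=` ~` K.
Proof.
move=> /compact_bounded[M [_ KM]]; exists (M + 1) => x /= Mx Kx.
by move: Mx; rewrite /far /= ltNge KM// ltrDl.
Qed.

(** The sets [far n%:R] decrease to the empty set, so continuity from above applies. *)
Lemma finite_measure_far mu (e : R) : 0 < e -> exists r, (mu (far r) < e%:E)%E.
Proof.
move=> e0.
have : (mu \o (fun n : nat => far n%:R)) @ \oo --> mu (\bigcap_n far n%:R).
  apply: nonincreasing_cvg_mu.
  - by rewrite ltey_eq fin_num_measure//; exact: measurable_far.
  - by move=> i; exact: measurable_far.
  - by apply: bigcapT_measurable => i; exact: measurable_far.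
  - by move=> m n mn; apply/subsetPset/far_subset; rewrite ler_nat.
rewrite (_ : \bigcap_n _ = set0) ?measure0; last first.
  apply/seteqP; split=> // x /(_ (truncn `|x : 'rV[R]_d|).+1 I) /=.
  by rewrite /far /= ltNge (ltW (truncnS_gt _)).
move=> /cvg_EFin_near/(_ e e0)[N _ /(_ N (leqnn N))[/= fN]].
rewrite sub0r normrN ger0_norm ?fine_ge0// => h.
by exists N%:R; rewrite -(fineK fN) lte_fin.
Qed.

End radius.

(** * Integral estimates from a small transport distance *)

Section forward.
Local Open Scope ereal_scope.
Context {R : realType} {d : nat}.
Implicit Types (mu nu : MM R d) (f g : Rd R d -> R).

Lemma Wp_ge0 (p : R) mu nu : 0 <= Wp p mu nu.
Proof. by rewrite /Wp; case: ifP => // _; exact: poweR_ge0. Qed.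

(** All three summands of a competitor are nonnegative, so each lies below the whole sum; its
    coefficient is at least [min a b], which leaves [e]. *)
Lemma Wab_lt (a b p e : R) mu nu : (0 < a)%R -> (0 < b)%R -> (0 < e)%R ->
  Wab a b p mu nu < (Num.min a b * e)%:E ->
  exists mt nt : MM R d, [/\ mass mt = mass nt, tv mu mt < e%:E,
    tv nu nt < e%:E & Wp p mt nt < e%:E].
Proof.
move=> a0 b0 e0 /ereal_inf_lt[_ [mt [nt [_ [_ [mnt ->]]]]] h].
have lt_aux c (X : \bar R) : (0 < c)%R -> (Num.min a b <= c)%R ->
    c%:E * X < (Num.min a b * e)%:E -> X < e%:E.
  move=> c0 mc cX; rewrite -(@lte_pmul2l _ c%:E)// -EFinM.
  by rewrite (lt_le_trans cX)// lee_fin ler_wpM2r// ltW.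
have a_ge0 (X : \bar R) : 0 <= X -> 0 <= a%:E * X by move=> X0; rewrite mule_ge0// lee_fin ltW.
have b_ge0 : 0 <= b%:E * Wp p mt nt by rewrite mule_ge0 ?Wp_ge0// lee_fin ltW.
have ha := a_ge0 _ (tv_ge0 mu mt); have hb := a_ge0 _ (tv_ge0 nu nt).
exists mt, nt; split => //.
- apply: (lt_aux a) => //; first by rewrite ge_min lexx.
  by apply: le_lt_trans h; rewrite -addeA leeDl// adde_ge0.
- apply: (lt_aux a) => //; first by rewrite ge_min lexx.
  by apply: le_lt_trans h; rewrite addeAC leeDr// adde_ge0.
- apply: (lt_aux b) => //; first by rewrite ge_min lexx orbT.
  by apply: le_lt_trans h; rewrite leeDr// adde_ge0.
Qed.

(** The chain is [mu], [mt], [nt], [nu]. The two total variation steps cost [M * e] each; the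
    transport step costs [eta] times the mass of [nt] plus [L e^p], where [e^p <= e] because
    [e <= 1 <= p]. *)
Lemma Wab_integral_le (a b p e eta L M : R) mu nu f g :
  (0 < a)%R -> (0 < b)%R -> (1 <= p)%R -> (0 < e)%R -> (e <= 1)%R ->
  (0 <= eta)%R -> (0 <= L)%R ->
  measurable_fun setT f -> measurable_fun setT g ->
  (forall x, 0 <= f x <= M)%R -> (forall x, 0 <= g x <= M)%R ->
  Wab a b p mu nu < (Num.min a b * e)%:E ->
  let err := (eta * (fine (mass nu) + 1) + (2 * M + L) * e)%:E in
  ((forall x y, f x <= g y + eta + L * eucl ((x : 'rV[R]_d) - y) `^ p)%R ->
   \int[mu]_x (f x)%:E <= \int[nu]_x (g x)%:E + err) /\
  ((forall x y, g y <= f x + eta + L * eucl ((x : 'rV[R]_d) - y) `^ p)%R ->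
   \int[nu]_x (g x)%:E <= \int[mu]_x (f x)%:E + err).
Proof.
move=> a0 b0 p1 e0 e1 eta0 L0 mf mg fM gM W err.
have [mt [nt [mE tvm tvn Wt]]] := Wab_lt _ _ _ _ _ _ a0 b0 e0 W.
have M0 : (0 <= M)%R by have /andP[/le_trans] := fM 0%R; apply.
have tv_int (m1 m2 : MM R d) (h : Rd R d -> R) :
    measurable_fun setT h -> (forall x, 0 <= h x <= M)%R -> tv m1 m2 < e%:E ->
    \int[m1]_x (h x)%:E <= \int[m2]_x (h x)%:E + (M * e)%:E.
  move=> mh hM t12; apply: (le_trans (le_integral_tv m1 m2 h M mh _ _)).
  - by move=> x; case/andP: (hM x).
  - by move=> x; case/andP: (hM x).
  - by rewrite leeD2l// EFinM lee_wpmul2l ?lee_fin// ltW.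
have ep : (e `^ p <= e)%R.
  by rewrite -[leRHS](powRr1 (ltW e0)); apply: ger_powR; rewrite // e0.
(* Testing total variation with the constant [1] bounds the mass of [nt] by that of [nu] plus
   [e <= 1], so the error only involves the given [nu]. *)
have nt1 : eta%:E * mass nt <= (eta * (fine (mass nu) + 1))%:E.
  rewrite EFinM lee_wpmul2l ?lee_fin//.
  have := le_integral_tv nt nu (cst 1%R) 1 (measurable_cst _) (fun=> ler01) (fun=> lexx 1%R).
  have c1 (m : MM R d) : \int[m]_x (cst 1%R x)%:E = mass m.
    by rewrite -[RHS]mul1e -integral_cst.
  rewrite !c1 mul1e EFinD fineK ?fin_num_measure//.
  move=> /le_trans; apply; rewrite leeD2l// tvC.
  by rewrite (le_trans (ltW tvn))// lee_fin.
have p0 : (0 < p)%R by apply: lt_le_trans p1.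
have f0 x : (0 <= f x)%R by case/andP: (fM x).
have g0 x : (0 <= g x)%R by case/andP: (gM x).
have [hfg hgf] := Wp_integral_le _ _ _ _ _ _ _ _ p0 e0 eta0 L0 mf mg f0 g0 mE Wt.
have combine (A B C D : \bar R) : A <= B + (M * e)%:E ->
    B <= C + eta%:E * mass nt + (L * e `^ p)%:E ->
    C <= D + (M * e)%:E -> A <= D + err.
  move=> AB BC CD; apply: (le_trans AB).
  apply: (@le_trans _ _ (D + (M * e)%:E + (eta * (fine (mass nu) + 1))%:E +
      (L * e)%:E + (M * e)%:E)).
    apply: leeD2r; apply: (le_trans BC); apply: leeD; first exact: leeD.
    by rewrite lee_fin ler_wpM2l.
  rewrite -!addeA leeD2l// -!EFinD lee_fin; lra.
split=> fg.
- apply: (combine _ _ _ _ _ (hfg fg)); first exact: tv_int.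
  by apply: tv_int => //; rewrite tvC.
- apply: (combine _ _ _ _ _ (hgf fg)); first exact: tv_int.
  by apply: tv_int => //; rewrite tvC.
Qed.

End forward.

Lemma bounded_integral_fin_num {R : realType} {d : nat} (mu : MM R d) (f : Rd R d -> R) (M : R) :
  measurable_fun setT f -> (forall x, 0 <= f x <= M) ->
  (\int[mu]_x (f x)%:E)%E \is a fin_num.
Proof.
move=> mf fM; have f0 x : 0 <= f x by case/andP: (fM x).
rewrite ge0_fin_numE; last by apply: integral_ge0 => x _; rewrite lee_fin.
apply: (@le_lt_trans _ _ (\int[mu]_x (cst M%:E) x)%E).
  apply: ge0_le_integral => //.
  - by move=> x _; rewrite lee_fin.
  - exact/measurable_EFinP.
  - by move=> x _; rewrite lee_fin; case/andP: (fM x).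
by rewrite integral_cst// ltey_eq fin_numM// fin_num_measure.
Qed.

(** * Limits along the sequence *)

Section forward_limits.
Context {R : realType} {d : nat}.
Variables (a b p : R) (mu_ : nat -> MM R d) (mu : MM R d).
Hypotheses (a0 : 0 < a) (b0 : 0 < b) (p1 : 1 <= p).
Hypothesis Wab0 : (fun n => Wab a b p (mu_ n) mu) @ \oo --> 0%E.

Let p_ge0 : 0 <= p. Proof. exact: le_trans p1. Qed.

Lemma near_Wab_lt e : 0 < e ->
  \forall n \near \oo, (Wab a b p (mu_ n) mu < (Num.min a b * e)%:E)%E.
Proof.
move=> e0; have m0 : 0 < Num.min a b * e by rewrite mulr_gt0// lt_min a0.
move: Wab0 => /cvg_EFin_near/(_ _ m0); apply: filterS => n [fW].
rewrite -(fineK fW) lte_fin sub0r normrN /=; exact: le_lt_trans (ler_norm _).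
Qed.

Lemma powR_eucl_ge (r : R) (x : 'rV[R]_d) : 0 <= r -> r <= `|x| -> r `^ p <= eucl x `^ p.
Proof.
move=> r0 rx; apply: ge0_ler_powR; rewrite ?nnegrE ?eucl_ge0//.
exact: le_trans (norm_le_eucl x).
Qed.

Lemma euclN (x : 'rV[R]_d) : eucl (- x) = eucl x.
Proof. by congr Num.sqrt; apply: eq_bigr => i _; rewrite mxE sqrrN. Qed.

(** Below the radius [r] of uniform continuity, [eta] is enough. Beyond it, [L = M / r^p] makes the
    last term at least [M], which dominates [f x]. *)
Lemma Cc_modulus (f : 'rV[R]_d -> R) (M : R) : Cc f -> (forall x, 0 <= f x <= M) ->
  forall eta, 0 < eta -> exists2 L, 0 <= L &
    forall x y, f x <= f y + eta + L * eucl (x - y) `^ p.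
Proof.
move=> Cf fM eta eta0; have [r r0 fr] := Cc_unif_continuous f Cf eta eta0.
have M0 : 0 <= M by have /andP[/le_trans] := fM 0; apply.
have rp0 : 0 < r `^ p by rewrite powR_gt0.
have L0 : 0 <= M / r `^ p by rewrite divr_ge0// ltW.
exists (M / r `^ p) => // x y; have [/fr|rxy] := ltP `|x - y| r.
  rewrite ltr_distlC => /andP[h1 h2].
  have := mulr_ge0 L0 (powR_ge0 (eucl (x - y)) p); lra.
have : M <= M / r `^ p * eucl (x - y) `^ p.
  rewrite -[leLHS](divfK (lt0r_neq0 rp0)) ler_wpM2l// powR_eucl_ge//; exact: ltW.
by have /andP[? ?] := fM x; have /andP[? ?] := fM y; lra.
Qed.

Lemma weak_cvg_nonneg (f : 'rV[R]_d -> R) (M : R) : Cc f -> (forall x, 0 <= f x <= M) ->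
  (fun n => \int[mu_ n]_x (f x)%:E)%E @ \oo --> (\int[mu]_x (f x)%:E)%E.
Proof.
move=> Cf fM.
have mf : measurable_fun setT (f : Rd R d -> R).
  by apply: continuous_measurable_Rd; exact: Cf.1.
have M0 : 0 <= M by have /andP[/le_trans] := fM 0; apply.
have ffin := bounded_integral_fin_num mu f M mf fM.
rewrite -(fineK ffin); apply: near_cvg_EFin => t t0.
rewrite fineK//; set m := fine (mass mu).
have m0 : 0 <= m by rewrite fine_ge0.
(* This [eta] satisfies [eta * (m + 1) = t / 2]. As [L] depends on [eta], the number [e] is chosen
   afterwards, to make [(2 * M + L) * e] at most [t / 2]. *)
have [L L0 fL] := Cc_modulus f M Cf fM (t / 2 / (m + 1)) ltac:(by rewrite !divr_gt0// ltr_pwDr).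
have D0 : 0 < 2 * M + L + 1 by lra.
pose e := Num.min 1 (t / 2 / (2 * M + L + 1)).
have e0 : 0 < e by rewrite lt_min ltr01 !divr_gt0.
have e1 : e <= 1 by rewrite ge_min lexx.
near=> n.
have W : (Wab a b p (mu_ n) mu < (Num.min a b * e)%:E)%E by near: n; exact: near_Wab_lt.
have eta0 : 0 <= t / 2 / (m + 1) by rewrite !divr_ge0// ?ltW// ltr_pwDr.
have [h1 h2] := Wab_integral_le _ _ _ _ _ _ _ _ _ _ _ a0 b0 p1 e0 e1 eta0 L0 mf mf fM fM W.
have err : t / 2 / (m + 1) * (m + 1) + (2 * M + L) * e <= t.
  rewrite divfK ?gt_eqF ?ltr_pwDr//.
  have : (2 * M + L + 1) * e <= t / 2.
    by rewrite mulrC -ler_pdivlMr// ge_min lexx orbT.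
  rewrite mulrDl mul1r; lra.
split.
  by apply: le_trans (h1 fL) _; rewrite leeD2l// lee_fin.
apply: le_trans (h2 _) _; last by rewrite leeD2l// lee_fin.
by move=> x y; have := fL y x; rewrite -opprB euclN.
Unshelve. all: by end_near. Qed.

(** The estimates concern nonnegative functions, so [f] is split into its positive and negative
    parts, again continuous with compact support. *)
Lemma weak_cvg_of_Wab : weak_cvg mu_ mu.
Proof.
move=> f Cf; have [M M0 fM] := Cc_bounded f Cf.
have Cmax (g : 'rV[R]_d -> R) : Cc g -> Cc (fun x => Num.max (g x) 0).
  move=> [cg [K [cK K0]]]; split.
    move=> x; apply: (@continuous_max _ _ g (fun=> 0)); first exact: cg.
    exact: cst_continuous.
  by exists K; split=> // x /K0 ->; rewrite maxxx.
have CN : Cc (fun x => - f x).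
  case: Cf => [cf [K [cK K0]]]; split.
    by move=> x; apply: (@continuousN _ R^o _ f); exact: cf.
  by exists K; split=> // x /K0 ->; rewrite oppr0.
have maxM (t : R) : `|t| <= M -> 0 <= Num.max t 0 <= M.
  by move=> tM; rewrite le_max lexx orbT /= ge_max M0 andbT (le_trans _ tM)// ler_norm.
have fpM x : 0 <= Num.max (f x) 0 <= M by exact: maxM.
have fnM x : 0 <= Num.max (- f x) 0 <= M by apply: maxM; rewrite normrN.
have E (m : MM R d) : (\int[m]_x (f x)%:E = \int[m]_x (Num.max (f x) 0)%:E -
   \int[m]_x (Num.max (- f x) 0)%:E)%E.
  rewrite integralE; congr (_ - _)%E; apply: eq_integral => x _.
    by rewrite funeposE EFin_max.
  by rewrite funenegE -EFinN EFin_max.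
rewrite E; under eq_fun do rewrite E.
apply: cvgeB; last 2 first.
- exact: (weak_cvg_nonneg _ M (Cmax f Cf)).
- exact: (weak_cvg_nonneg _ M (Cmax _ CN)).
apply: fin_num_adde_defr; apply: (bounded_integral_fin_num _ _ M) => //.
by apply: continuous_measurable_Rd; exact: (Cmax f Cf).1.
Qed.

Lemma tight_of_Wab : tight mu_.
Proof.
move=> eps eps0.
have [r hr] := finite_measure_far mu (eps / 2) ltac:(by rewrite divr_gt0).
(* With [eta = 0] and [M = L = 1] the error is [3 * e], hence [eps / 6] to keep it within
   [eps / 2]. *)
pose e := Num.min 1 (eps / 6).
have e0 : 0 < e by rewrite lt_min ltr01 divr_gt0.
have e1 : e <= 1 by rewrite ge_min lexx.
have indic01 (A : set (Rd R d)) x : 0 <= (\1_A x : R) <= 1.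
  by rewrite indicE; case: (_ \in _); rewrite lexx ler01.
have mfar s : measurable_fun setT (\1_(far s) : Rd R d -> R).
  by apply: measurable_indic; exact: measurable_far.
have farN : \forall n \near \oo, (mu_ n (far (r + 1)) < eps%:E)%E.
  near=> n.
  have W : (Wab a b p (mu_ n) mu < (Num.min a b * e)%:E)%E by near: n; exact: near_Wab_lt.
  have [h _] := Wab_integral_le _ _ _ _ 0 1 1 (mu_ n) mu \1_(far (r + 1)) \1_(far r)
    a0 b0 p1 e0 e1 (lexx _) ler01 (mfar _) (mfar _) (indic01 _) (indic01 _) W.
  move: h; rewrite !integral_indic//; [|exact: measurable_far..].
  rewrite !setIT => /(_ _)/le_lt_trans; apply.
    move=> x y; rewrite addr0 mul1r !indicE.
    have [|] := boolP (x \in _); last by rewrite addr_ge0// powR_ge0.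
    have [_ _|] := boolP (y \in _); first by rewrite lerDl powR_ge0.
    (* A point of [far (r + 1)] and one outside [far r] are at least [1] apart, so the cost term
       alone dominates the indicator. *)
    rewrite notin_setE inE /far /= add0r => /negP; rewrite -leNgt => yr xr.
    have xy1 : 1 <= `|(x : 'rV[R]_d) - y|.
      by have := ler_normD ((x : 'rV[R]_d) - y) y; rewrite subrK; lra.
    by have := powR_eucl_ge 1 _ ler01 xy1; rewrite powR1.
  rewrite mul0r add0r (_ : eps%:E = (eps / 2)%:E + (eps / 2)%:E)%E; last first.
    by rewrite -EFinD -splitr.
  rewrite lte_leD// lee_fin; have : e <= eps / 6 by rewrite ge_min lexx orbT.
  lra.
have [N _ hN] := farN.
(* The finitely many indices below [N] get radii of their own; the maximum of these and [r + 1]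
   works for all [n]. *)
have /choice[s hs] n := finite_measure_far (mu_ n) eps eps0.
pose t := \big[Num.max/r + 1]_(i < N) s i.
exists (~` far t); split; first exact: near_compact.
move=> n; rewrite setCK.
have le_far q : q <= t -> (mu_ n (far q) < eps%:E)%E -> (mu_ n (far t) < eps%:E)%E.
  move=> qt; apply: le_lt_trans; rewrite le_measure ?inE//; [exact: measurable_far..|].
  exact: far_subset.
have [nN|Nn] := ltnP n N.
  apply: (le_far (s n)); last exact: hs.
  exact: (le_bigmax _ _ (Ordinal nN)).
apply: (le_far (r + 1)); last exact: hN.
exact: bigmax_ge_id.
Unshelve. all: by end_near. Qed.

End forward_limits.

(** * Cell-wise couplings subordinate to a partition of unity *)

Section density_lemmas.
Local Open Scope ereal_scope.
Context d (T : measurableType d) (R : realType).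

(** The set where [h > B] lies in the zero set of [f], so it is null for the density and hence for
    [m]. Bounds on the support of a density thus become almost everywhere bounds on moments and
    costs. *)
Lemma density_ae_le (mu : {measure set T -> \bar R}) (f : T -> R)
    (f0 : forall x, (0 <= f x)%R) (mf : measurable_fun setT f)
    (m : {measure set T -> \bar R}) (h : T -> R) (B : R) :
  (forall A, density mu f0 mf A = 0 -> m A = 0) ->
  measurable_fun setT h -> (forall x, f x != 0%R -> (h x <= B)%R) ->
  {ae m, forall x, setT x -> (h x)%:E <= B%:E}.
Proof.
move=> mE mh hB; exists [set x | (B < h x)%R]; split.
- have := mh measurableT _ (measurable_itv `]B, +oo[); rewrite setTI.
  by congr measurable; apply/seteqP; split=> x /=; rewrite in_itv/= andbT.
- apply: mE; apply: density_eq0.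
    have := mh measurableT _ (measurable_itv `]B, +oo[); rewrite setTI.
    by congr measurable; apply/seteqP; split=> x /=; rewrite in_itv/= andbT.
  move=> x /= Bh; apply/eqP/negPn/negP => /hB; rewrite leNgt Bh//.
- by move=> x /= /not_implyP[_ /negP]; rewrite lee_fin -ltNge.
Qed.

Lemma finite_density (mu : {finite_measure set T -> \bar R}) (f : T -> R)
    (f0 : forall x, (0 <= f x)%R) (mf : measurable_fun setT f) :
  (forall x, (f x <= 1)%R) ->
  exists m : {finite_measure set T -> \bar R}, forall A, m A = density mu f0 mf A.
Proof.
move=> f1.
have fin : fin_num_fun (density mu f0 mf).
  move=> A mA; rewrite ge0_fin_numE ?measure_ge0//.
  apply: (@le_lt_trans _ _ (mu A)); last by rewrite ltey_eq fin_num_measure.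
  rewrite -[leRHS]mul1e -integral_cst//; apply: ge0_le_integral => //.
  - by move=> x _; rewrite lee_fin.
  - by apply/measurable_EFinP; exact: measurable_funTS.
  - by move=> x _; rewrite lee_fin.
pose mx := Measure_isFinite.Build _ _ _ (density mu f0 mf) fin.
pose m : {finite_measure set T -> \bar R} := HB.pack (Measure.sort (density mu f0 mf)) mx.
by exists m.
Qed.

End density_lemmas.

Lemma ge0_integral_prod d1 d2 (T1 : measurableType d1) (T2 : measurableType d2)
    (R : realType) (m1 : {finite_measure set T1 -> \bar R})
    (m2 : {finite_measure set T2 -> \bar R}) (f : T1 -> R) (g : T2 -> R) A B :
  measurable A -> measurable B ->
  measurable_fun setT f -> measurable_fun setT g ->
  (forall x, 0 <= f x) -> (forall x, 0 <= g x) ->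
  (\int[m1 \x m2]_(z in A `*` B) (f z.1 * g z.2)%:E =
   \int[m1]_(x in A) (f x)%:E * \int[m2]_(y in B) (g y)%:E)%E.
Proof.
move=> mA mB mf mg f0 g0.
pose fA x := f x * \1_A x; pose gB y := g y * \1_B y.
have mfA : measurable_fun setT fA by apply: measurable_funM => //; exact: measurable_indic.
have mgB : measurable_fun setT gB by apply: measurable_funM => //; exact: measurable_indic.
have fA0 x : 0 <= fA x by rewrite mulr_ge0// indicE.
have gB0 x : 0 <= gB x by rewrite mulr_ge0// indicE.
have -> : (\int[m1]_(x in A) (f x)%:E = \int[m1]_x (fA x)%:E)%E.
  rewrite integral_mkcond; apply: eq_integral => x _.
  by rewrite -/(EFin \o f) restrict_EFin patch_indic.
have -> : (\int[m2]_(y in B) (g y)%:E = \int[m2]_y (gB y)%:E)%E.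
  rewrite integral_mkcond; apply: eq_integral => y _.
  by rewrite -/(EFin \o g) restrict_EFin patch_indic.
have -> : (\int[m1 \x m2]_(z in A `*` B) (f z.1 * g z.2)%:E =
    \int[m1 \x m2]_z (fA z.1 * gB z.2)%:E)%E.
  rewrite integral_mkcond; apply: eq_integral => z _.
  rewrite patchE /fA /gB !indicE in_setX.
  case: (z.1 \in A) => /=; last by rewrite mulr0 mul0r.
  by case: (z.2 \in B); rewrite /= !(mulr1, mulr0).
rewrite fubini_tonelli1//; last 2 first.
- apply/measurable_EFinP; apply: measurable_funM; exact: measurableT_comp.
- by move=> z; rewrite lee_fin mulr_ge0.
rewrite /fubini_F /=.
under eq_integral => x _.
  under eq_integral do rewrite EFinM.
  rewrite ge0_integralZl_EFin//; last 2 first.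
  - by move=> y _; rewrite lee_fin.
  - exact/measurable_EFinP.
  over.
rewrite ge0_integralZr//.
- exact/measurable_EFinP.
- by move=> x _; rewrite lee_fin.
- by apply: integral_ge0 => y _; rewrite lee_fin.
Qed.

Lemma integral_weighted_sum d (T : measurableType d) (R : realType)
    (m : {measure set T -> \bar R}) (A : set T) (N : nat) (q : 'I_N -> R)
    (h : 'I_N -> T -> R) : measurable A ->
  (forall i, measurable_fun setT (h i)) -> (forall i x, 0 <= h i x) ->
  (forall i, 0 <= q i) ->
  (\int[m]_(x in A) (\sum_i q i * h i x)%:E =
   \sum_i (q i)%:E * \int[m]_(x in A) (h i x)%:E)%E.
Proof.
move=> mA mh h0 q0.
under eq_integral do rewrite -sumEFin.
rewrite ge0_integral_sum//; last 2 first.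
- move=> i; apply/measurable_EFinP; apply: measurable_funM => //.
  exact: measurable_funTS.
- by move=> i x _; rewrite lee_fin mulr_ge0.
apply: eq_bigr => i _; under eq_integral do rewrite EFinM.
rewrite ge0_integralZl_EFin//.
- by move=> x _; rewrite lee_fin.
- by apply/measurable_EFinP; exact: measurable_funTS.
Qed.

(** If [x = 0], the left side has a zero factor and the minimum is zero because [y >= 0]; cells
    without mass thus obey the general formula. *)
Lemma min_divK {R : realType} (x y : R) : 0 <= x -> 0 <= y ->
  Num.min x y / x * x = Num.min x y.
Proof.
move=> x0 y0; have [->|xn0] := eqVneq x 0; last by rewrite divfK.
by rewrite mulr0 min_l.
Qed.

(** * Matching mass inside the cells *)

Section partition_bound.
Context {R : realType} {d : nat}.
Variables (N : nat) (phi : 'I_N -> 'rV[R]_d -> R) (c : 'I_N -> 'rV[R]_d) (r : R).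
Hypothesis mphi : forall i, measurable_fun setT (phi i : Rd R d -> R).
Hypothesis phi0 : forall i x, 0 <= phi i x.
Hypothesis phi1 : forall x, \sum_i phi i x <= 1.
Hypothesis phir : forall i x, phi i x != 0 -> `|c i - x| <= r.
Implicit Types (mu nu : MM R d) (q : 'I_N -> R).

Lemma phi_le1 i x : phi i x <= 1.
Proof. by apply: le_trans (phi1 x); rewrite (bigD1 i)//= lerDl sumr_ge0. Qed.

Definition cell_mass mu i : R := fine (\int[mu]_x (phi i x)%:E).

Lemma cell_massE mu i : (\int[mu]_x (phi i x)%:E)%E = (cell_mass mu i)%:E.
Proof.
rewrite fineK//; apply: (bounded_integral_fin_num _ _ 1) => // x.
by rewrite phi0 phi_le1.
Qed.

Lemma cell_mass_ge0 mu i : 0 <= cell_mass mu i.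
Proof. by rewrite fine_ge0// integral_ge0// => x _; rewrite lee_fin. Qed.

Lemma sum_cell_massE mu :
  (\int[mu]_x (\sum_i phi i x)%:E)%E = (\sum_i cell_mass mu i)%:E.
Proof.
under eq_integral do rewrite -sumEFin.
rewrite ge0_integral_sum//; last 2 first.
- by move=> i; exact/measurable_EFinP.
- by move=> i x _; rewrite lee_fin.
by rewrite -sumEFin; apply: eq_bigr => i _; rewrite cell_massE.
Qed.

Lemma measurable_sum_phi : measurable_fun setT (fun x : Rd R d => (\sum_i phi i x)%:E).
Proof. by apply/measurable_EFinP; apply: measurable_sum. Qed.

Lemma sum_cell_mass_le mu : \sum_i cell_mass mu i <= fine (mass mu).
Proof.
rewrite -lee_fin fineK ?fin_num_measure// -sum_cell_massE.
rewrite /mass -[leRHS]mul1e -integral_cst//; apply: ge0_le_integral => //.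
- by move=> x _; rewrite lee_fin sumr_ge0.
- exact: measurable_sum_phi.
- by move=> x _; rewrite lee_fin.
Qed.

Lemma mass_le_cells mu (s : R) :
  (forall x, ~ far s x -> \sum_i phi i x = 1) ->
  (mass mu <= (\sum_i cell_mass mu i)%:E + mu (far s))%E.
Proof.
move=> phi_eq1; rewrite -sum_cell_massE.
have mfar : measurable (far s : set (Rd R d)) := measurable_far s.
have mind : measurable_fun setT (fun x : Rd R d => (\1_(far s) x : R)%:E).
  by apply/measurable_EFinP; exact: measurable_indic.
have sum0 x : 0 <= \sum_i phi i x by exact: sumr_ge0.
rewrite -(setIT (far s)) -integral_indic// -ge0_integralD//; last 2 first.
- by move=> x _; rewrite lee_fin.
- exact: measurable_sum_phi.
rewrite /mass -[leLHS]mul1e -integral_cst//; apply: ge0_le_integral => //.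
- exact: emeasurable_funD measurable_sum_phi mind.
move=> x _; rewrite -EFinD lee_fin.
have [fx|/phi_eq1 ->] := pselect (far s x); last by rewrite lerDl indicE.
by rewrite indicE mem_set//= lerDr.
Qed.

(** The mass that both measures can supply to cell [i]. *)
Definition common mu nu i : R := Num.min (cell_mass mu i) (cell_mass nu i).

Lemma common_ge0 mu nu i : 0 <= common mu nu i.
Proof. by rewrite le_min !cell_mass_ge0. Qed.

Definition weight q (x : Rd R d) : R := \sum_i q i * phi i x.

Lemma weight_ge0 q : (forall i, 0 <= q i) -> forall x, 0 <= weight q x.
Proof. by move=> q0 x; apply: sumr_ge0 => i _; rewrite mulr_ge0. Qed.

Lemma measurable_weight q : measurable_fun setT (weight q).
Proof. by apply: measurable_sum => i; apply: measurable_funM. Qed.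

Lemma weight_neq0 q x : weight q x != 0 -> exists i, phi i x != 0.
Proof.
move=> wx; apply: contrapT => /forallNP h; move/eqP: wx; apply.
rewrite /weight big1// => i _.
by have /negP/negPn/eqP -> := h i; rewrite mulr0.
Qed.

(* The part of [mu] that can be matched with [nu] inside the cells. *)
Lemma matched_part mu nu (p : R) : 0 <= p -> exists mt : MM R d,
  [/\ forall A, measurable A -> mt A = (\sum_i (common mu nu i / cell_mass mu i)%:E *
        \int[mu]_(x in A) (phi i x)%:E)%E,
      mass mt = (\sum_i common mu nu i)%:E,
      finite_moment p mt &
      (tv mu mt <= mass mu - (\sum_i common mu nu i)%:E)%E].
Proof.
move=> p0; pose q i := common mu nu i / cell_mass mu i.
have q0 i : 0 <= q i by rewrite divr_ge0 ?common_ge0 ?cell_mass_ge0.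
have w0 := weight_ge0 q q0; have mw := measurable_weight q.
have w1 x : weight q x <= 1.
  apply: le_trans (phi1 x); apply: ler_sum => i _; rewrite ler_piMl//.
  have := cell_mass_ge0 mu i; rewrite le_eqVlt => /orP[/eqP h|h].
    by rewrite /q -h invr0 mulr0.
  by rewrite ler_pdivrMr// mul1r ge_min lexx.
have [mt mtE] := finite_density _ _ _ mu (weight q) w0 mw w1.
have mtS A : measurable A -> mt A = (\sum_i (q i)%:E * \int[mu]_(x in A) (phi i x)%:E)%E.
  by move=> mA; rewrite mtE /density integral_weighted_sum.
have massE : mass mt = (\sum_i common mu nu i)%:E.
  rewrite /mass mtS// -sumEFin; apply: eq_bigr => i _.
  by rewrite cell_massE -EFinM min_divK ?cell_mass_ge0.
exists mt; split => //.
  (* A point of nonzero weight lies within [r] of some centre, and the sum dominates the norm of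
     each centre. So [B] bounds its Euclidean length. *)
  pose B := d%:R * (\sum_i `|c i| + r).
  have meucl : measurable_fun setT (fun x : Rd R d => eucl (x : 'rV[R]_d) `^ p).
    apply: (measurableT_comp (measurable_powR p)).
    by apply: measurable_eucl; exact: measurable_coord.
  apply: (@le_lt_trans _ _ (\int[mt]_x (cst (B `^ p)%:E) x)%E).
    apply: ae_ge0_le_integral => //.
    - by move=> x _; rewrite lee_fin powR_ge0.
    - exact/measurable_EFinP.
    - by move=> x _; rewrite lee_fin powR_ge0.
    apply: (density_ae_le _ _ _ mu (weight q) w0 mw) => //.
      by move=> A; apply: etrans; exact: mtE.
    move=> x /weight_neq0[i /phir cr].
    have eB : eucl (x : 'rV[R]_d) <= B.
      apply: le_trans (eucl_le_norm _) _; rewrite ler_wpM2l//.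
      have h : `|c i| <= \sum_i `|c i| by rewrite (bigD1 i)//= lerDl sumr_ge0.
      have := ler_normB (c i) (c i - x); rewrite opprB addrC subrK => h'.
      by rewrite (le_trans h')// lerD.
    by apply: ge0_ler_powR => //; rewrite nnegrE ?eucl_ge0// (le_trans _ eB)// eucl_ge0.
  by rewrite integral_cst// ltey_eq fin_numM// fin_num_measure.
rewrite -massE; apply: (tv_density _ _ _ w0 mw) => // A _; exact: mtE.
Qed.

Lemma commonC mu nu i : common mu nu i = common nu mu i.
Proof. by rewrite /common minC. Qed.

(** Density with respect to [mu \x nu] of the coupling before normalisation: in cell [i], the
    product of [phi i mu] and [phi i nu] rescaled to total mass [common mu nu i]. *)
Definition joint mu nu (z : Rd R d * Rd R d) : R :=
  \sum_i (common mu nu i / (cell_mass mu i * cell_mass nu i)) * (phi i z.1 * phi i z.2).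

Lemma joint_coef_ge0 mu nu i :
  0 <= common mu nu i / (cell_mass mu i * cell_mass nu i).
Proof. by rewrite divr_ge0 ?common_ge0// mulr_ge0 ?cell_mass_ge0. Qed.

Lemma joint_ge0 mu nu z : 0 <= joint mu nu z.
Proof. by apply: sumr_ge0 => i _; rewrite mulr_ge0 ?joint_coef_ge0// mulr_ge0. Qed.

(** Integrating out the second variable produces the factor [cell_mass nu i], which cancels; if it
    is zero, then so is [common mu nu i]. *)
Lemma joint_coefl mu nu i :
  common mu nu i / (cell_mass mu i * cell_mass nu i) * cell_mass nu i =
  common mu nu i / cell_mass mu i.
Proof.
have [h|h] := eqVneq (cell_mass nu i) 0; last by rewrite invfM mulrA divfK.
by rewrite h mulr0 /common h min_r ?cell_mass_ge0// mul0r.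
Qed.

Lemma joint_coefr mu nu i :
  common mu nu i / (cell_mass mu i * cell_mass nu i) * cell_mass mu i =
  common mu nu i / cell_mass nu i.
Proof. by rewrite mulrC [cell_mass mu i * _]mulrC mulrC commonC joint_coefl. Qed.

Lemma measurable_prod_cell i :
  measurable_fun setT (fun z : Rd R d * Rd R d => phi i z.1 * phi i z.2).
Proof.
apply: measurable_funM.
- exact: (measurableT_comp (mphi i) measurable_fst).
- exact: (measurableT_comp (mphi i) measurable_snd).
Qed.

Lemma measurable_joint mu nu : measurable_fun setT (joint mu nu).
Proof.
by apply: measurable_sum => i; apply: measurable_funM => //; exact: measurable_prod_cell.
Qed.

Lemma joint_rectangle mu nu (A B : set (Rd R d)) : measurable A -> measurable B ->
  density (mu \x nu)%E (joint_ge0 mu nu) (measurable_joint mu nu) (A `*` B) =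
  (\sum_i (common mu nu i / (cell_mass mu i * cell_mass nu i))%:E *
    (\int[mu]_(x in A) (phi i x)%:E * \int[nu]_(x in B) (phi i x)%:E))%E.
Proof.
move=> mA mB; rewrite /density integral_weighted_sum//; last 4 first.
- exact: measurableX.
- exact: measurable_prod_cell.
- by move=> i z; rewrite mulr_ge0.
- by move=> i; exact: joint_coef_ge0.
by apply: eq_bigr => i _; rewrite ge0_integral_prod.
Qed.

(** The measure with density [joint] has marginals [mt] and [nt] and total mass [C]. Almost
    everywhere both points are within [r] of the same centre, hence at most [2 * r] apart in the
    norm; the factor [d] passes to Euclidean distance. *)
Lemma matched_coupling mu nu (mt nt : MM R d) (C : R) :
  0 < C -> C = \sum_i common mu nu i ->
  (forall A, measurable A -> mt A = (\sum_i (common mu nu i / cell_mass mu i)%:E *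
        \int[mu]_(x in A) (phi i x)%:E)%E) ->
  (forall A, measurable A -> nt A = (\sum_i (common mu nu i / cell_mass nu i)%:E *
        \int[nu]_(x in A) (phi i x)%:E)%E) ->
  mass mt = C%:E -> mass nt = C%:E ->
  exists2 pi, normalized_coupling mt nt pi &
    forall p, 0 <= p -> (\int[pi]_z ((eucl ((z.1 : 'rV[R]_d) - z.2)) `^ p)%:E <=
      ((d%:R * (2 * r)) `^ p)%:E)%E.
Proof.
move=> C0 CE mtS ntS mtC ntC.
pose rho : {measure set (Rd R d * Rd R d)%type -> \bar R} :=
  density (mu \x nu)%E (joint_ge0 mu nu) (measurable_joint mu nu).
have rho1 A : measurable A -> rho (A `*` setT) = mt A.
  move=> mA; apply: etrans (joint_rectangle _ _ _ _ mA measurableT) _.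
  rewrite mtS//; apply: eq_bigr => i _.
  by rewrite cell_massE muleCA muleC -EFinM joint_coefl.
have rho2 A : measurable A -> rho (setT `*` A) = nt A.
  move=> mA; apply: etrans (joint_rectangle _ _ _ _ measurableT mA) _.
  rewrite ntS//; apply: eq_bigr => i _.
  by rewrite cell_massE muleA -EFinM joint_coefr.
have rhoT : rho setT = C%:E by rewrite -setXTT rho1.
pose pi : probability (Rd R d * Rd R d)%type R :=
  (* The Dirac mass is the default of [mnormalize] for a zero or infinite total mass; here the mass
     is the positive real [C]. *)
  mnormalize rho (dirac (point : (Rd R d * Rd R d)%type)).
have piE E : pi E = (rho E * C^-1%:E)%E.
  rewrite /pi /= /mnormalize.
  have -> : rho [set: Rd R d * Rd R d] = C%:E by exact: rhoT.
  by rewrite eqe gt_eqF.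
clearbody pi; exists pi.
  split=> A mA; apply: etrans (piE _) _.
    by rewrite rho1// -/(mass mt) mtC EFinM fineK// fin_num_measure.
  by rewrite rho2// -/(mass nt) ntC EFinM fineK// fin_num_measure.
move=> p p0.
have pi_1 : (\int[pi]_z (cst ((d%:R * (2 * r)) `^ p)%:E z) = ((d%:R * (2 * r)) `^ p)%:E)%E.
  rewrite integral_cst// -[RHS]mule1; congr (_ * _)%E; exact: probability_setT.
rewrite -pi_1; apply: ae_ge0_le_integral => //.
- by move=> x _; rewrite lee_fin powR_ge0.
- exact: measurable_cost.
- by move=> x _; rewrite lee_fin powR_ge0.
apply: (density_ae_le _ _ _ _ _ (joint_ge0 mu nu) (measurable_joint mu nu)).
- by move=> A h; apply: etrans (piE A) _; rewrite (_ : rho A = 0%E); [exact: mul0e|exact: h].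
- by apply/measurable_EFinP; exact: measurable_cost.
move=> z jz.
have [i] : exists i, phi i z.1 * phi i z.2 != 0.
  apply: contrapT => /forallNP h; move/eqP: jz; apply.
  rewrite /joint big1// => i _.
  by have /negP/negPn/eqP -> := h i; rewrite mulr0.
rewrite mulf_eq0 negb_or => /andP[/phir h1 /phir h2].
have h3 : eucl ((z.1 : 'rV[R]_d) - z.2) <= d%:R * (2 * r).
  apply: le_trans (eucl_le_norm _) _; rewrite ler_wpM2l//.
  have := ler_normB (c i - z.2) (c i - z.1).
  rewrite opprB addrC addrA subrK => h'; lra.
by apply: ge0_ler_powR => //; rewrite nnegrE ?eucl_ge0// (le_trans _ h3)// eucl_ge0.
Qed.

(** The two matched parts compete in the infimum, the second obtained by exchanging [mu] and [nu].
    Unmatched mass pays for total variation, the diameter of the cells for [Wp]. *)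
Lemma Wab_partition_le (a b p C : R) mu nu :
  0 <= a -> 0 <= b -> 0 < p -> 0 <= r -> C = \sum_i common mu nu i ->
  (Wab a b p mu nu <= a%:E * (mass mu - C%:E) + a%:E * (mass nu - C%:E) +
    (b * (C `^ p^-1 * (d%:R * (2 * r))))%:E)%E.
Proof.
move=> a0 b0 p0 r0 CE; have p_ge0 := ltW p0.
have [mt [mtS mtC mtm tmt]] := matched_part mu nu p p_ge0.
have [nt [ntS ntC ntm tnt]] := matched_part nu mu p p_ge0.
have CC : \sum_i common nu mu i = C by rewrite CE; apply: eq_bigr => i _; exact: commonC.
rewrite -CE in mtC tmt; rewrite CC in ntC tnt.
apply: ge_ereal_inf; eexists; first by exists mt, nt; rewrite mtC ntC.
apply: leeD; first by apply: leeD; rewrite lee_wpmul2l ?lee_fin.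
rewrite EFinM lee_wpmul2l ?lee_fin// /Wp mtC eqe.
have : 0 <= C by rewrite CE sumr_ge0// => i _; exact: common_ge0.
rewrite le_eqVlt => /orP[/eqP <-|C0]; first by rewrite eqxx lee_fin mulr_ge0 ?powR_ge0// !mulr_ge0.
rewrite gt_eqF//.
have ntS' A : measurable A -> nt A = (\sum_i (common mu nu i / cell_mass nu i)%:E *
    \int[nu]_(x in A) (phi i x)%:E)%E.
  by move=> mA; rewrite ntS//; apply: eq_bigr => i _; rewrite commonC.
have [pi npi cost_pi] := matched_coupling mu nu mt nt C C0 CE mtS ntS' mtC ntC.
have D0 : 0 <= d%:R * (2 * r) by rewrite !mulr_ge0.
have inf_ge0 : (0 <= ereal_inf [set \int[pi]_z ((eucl ((z.1 : 'rV[R]_d) - z.2)) `^ p)%:E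
    | pi in normalized_coupling mt nt])%E.
  by apply: le_ereal_inf_tmp => _ [? _ <-]; apply: integral_ge0 => z _; rewrite lee_fin powR_ge0.
have -> : (C `^ p^-1 * (d%:R * (2 * r)))%:E = ((C%:E * ((d%:R * (2 * r)) `^ p)%:E) `^ p^-1)%E.
  move: D0; move: (d%:R * (2 * r)) => D D0.
  rewrite -EFinM poweR_EFin powRM ?powR_ge0 ?(ltW C0)// -powRrM divff ?gt_eqF//.
  by rewrite powRr1.
apply: gt0_ler_poweR.
- by rewrite invr_ge0.
- by rewrite in_itv/= leey mule_ge0// lee_fin ltW.
- by rewrite in_itv/= leey mule_ge0// lee_fin ?powR_ge0// ltW.
rewrite lee_wpmul2l ?lee_fin ?(ltW C0)//.
by apply: ge_ereal_inf; eexists; [exists pi|exact: cost_pi p p_ge0].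
Qed.

End partition_bound.

(** * The equivalence *)

Lemma Wab_ge0 {R : realType} {d : nat} (a b p : R) (mu nu : MM R d) :
  0 <= a -> 0 <= b -> (0 <= Wab a b p mu nu)%E.
Proof.
move=> a0 b0; apply: le_ereal_inf_tmp => _ [mt [nt [_ [_ [_ ->]]]]].
by rewrite !adde_ge0// mule_ge0 ?tv_ge0 ?Wp_ge0 ?lee_fin.
Qed.

Lemma min_dist {R : realType} (x y : R) :
  x - Num.min x y <= `|y - x| /\ y - Num.min x y <= `|y - x|.
Proof.
have h1 := ler_norm (y - x); have := ler_norm (- (y - x)); rewrite normrN => h2.
by case: (leP x y) => _; split; lra.
Qed.

Lemma Wab_cvg0 {R : realType} {d : nat} (a b p : R) (mu_ : nat -> MM R d) (mu : MM R d) :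
  0 < a -> 0 < b -> 1 <= p -> weak_cvg mu_ mu -> tight mu_ ->
  (fun n => Wab a b p (mu_ n) mu) @ \oo --> 0%E.
Proof.
move=> a0 b0 p1 wmu tmu; have p0 : 0 < p := lt_le_trans ltr01 p1.
apply: near_cvg_EFin => t t0.
(* Each of the two measures will leave at most [2 * e] unmatched, so the total variation terms cost
   at most [4 * (a * e) = t / 2]. *)
pose e := t / (8 * a).
have e0 : 0 < e by rewrite divr_gt0// mulr_gt0.
have ae : 4 * (a * e) = t / 2.
  by rewrite /e; field; rewrite gt_eqF.
have [K1 [cK1 hK1]] := tmu e e0.
have [s1 s1K] := compact_far K1 cK1.
have [s2 hs2] := finite_measure_far mu e e0.
pose s := Num.max s1 s2.
have le_far (m : MM R d) (B : set (Rd R d)) : measurable B -> far s `<=` B ->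
    (m B < e%:E -> m (far s) < e%:E)%E.
  move=> mB sB; apply: le_lt_trans; rewrite le_measure ?inE//.
  exact: measurable_far.
have far_n n : (mu_ n (far s) < e%:E)%E.
  apply: (le_far _ (~` K1)); last exact: hK1.
    apply: measurableC; apply: closed_measurable_Rd.
    by apply: compact_closed => //; exact: norm_hausdorff.
  apply: subset_trans s1K; apply: far_subset; by rewrite le_max lexx.
have far_mu : (mu (far s) < e%:E)%E.
  apply: (le_far _ (far s2)) => //; first exact: measurable_far.
  by apply: far_subset; rewrite le_max lexx orbT.
pose m := fine (mass mu); have m0 : 0 <= m by rewrite fine_ge0.
(* [D * r] bounds the transport term once [C <= m], and [r] makes it at most [t / 2]; the added [1]
   keeps the denominator positive when [D = 0]. *)
pose D := b * m `^ p^-1 * d%:R * 2.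
have D0 : 0 <= D by rewrite !mulr_ge0 ?powR_ge0// ltW.
pose r := t / 2 / (D + 1).
have r0 : 0 < r by rewrite !divr_gt0// ltr_pwDr.
have Dr : D * r <= t / 2.
  rewrite /r mulrA ler_pdivrMr ?ltr_pwDr// mulrC ler_wpM2l// ?divr_ge0 ?ltW//.
  by rewrite ltrDl.
have [N [phi [Cphi phi0 phi1 phiK phir']]] :=
  partition_of_unity (~` far s : set 'rV[R]_d) r (near_compact s) r0.
have [c phir] := choice phir'.
have mphi i : measurable_fun setT (phi i : Rd R d -> R).
  by apply: continuous_measurable_Rd; exact: (Cphi i).1.
have massE := cell_massE N phi mphi phi0 phi1.
(* The errors of the [N] cells add up to at most [e]; the successor avoids dividing by zero when
   there is no cell. *)
have e1 : 0 < e / N.+1%:R by rewrite divr_gt0.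
near=> n.
have close i : `|cell_mass N phi mu i - cell_mass N phi (mu_ n) i| < e / N.+1%:R.
  (* The cells were fixed before [n], so finitely many instances of weak convergence hold at once
     for large [n]. *)
  move: i; near: n; apply: filter_forall => i.
  have := wmu (phi i) (Cphi i); rewrite massE => /cvg_EFin_near/(_ _ e1).
  by apply: filterS => n [].
pose A := \sum_i cell_mass N phi (mu_ n) i; pose B := \sum_i cell_mass N phi mu i.
pose C := \sum_i common N phi (mu_ n) mu i.
have sum_close : \sum_i `|cell_mass N phi mu i - cell_mass N phi (mu_ n) i| <= e.
  apply: (@le_trans _ _ (\sum_(i < N) e / N.+1%:R)).
    by apply: ler_sum => i _; exact/ltW.
  rewrite sumr_const card_ord -[leLHS]mulr_natr mulrAC ler_pdivrMr//.
  by rewrite ler_wpM2l ?(ltW e0)// ler_nat.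
have AC : A - C <= e.
  rewrite -sumrB; apply: le_trans sum_close; apply: ler_sum => i _.
  exact: (min_dist _ _).1.
have BC : B - C <= e.
  rewrite -sumrB; apply: le_trans sum_close; apply: ler_sum => i _.
  exact: (min_dist _ _).2.
(* One [e] is for the mass in [far s], the other for the excess of the cell masses over [C]. *)
have part_mass (m' : MM R d) (S : R) : S = \sum_i cell_mass N phi m' i ->
    (m' (far s) < e%:E)%E -> S - C <= e -> (mass m' - C%:E <= (2 * e)%:E)%E.
  move=> SE fm SC; rewrite leeBlDr//.
  apply: (le_trans (mass_le_cells N phi mphi phi0 phi1 m' s _)).
    by move=> x nfx; apply: phiK.
  rewrite -SE; apply: (le_trans (leeD2l _ (ltW fm))).
  by rewrite -!EFinD lee_fin; lra.
have Cm : C <= m.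
  apply: (@le_trans _ _ B).
    by apply: ler_sum => i _; rewrite ge_min lexx orbT.
  exact: sum_cell_mass_le.
have C0 : 0 <= C by apply: sumr_ge0 => i _; exact: common_ge0.
rewrite add0e; split; last first.
  by apply: adde_ge0; [apply: Wab_ge0; exact: ltW|rewrite lee_fin ltW].
apply: (le_trans (Wab_partition_le N phi c r mphi phi0 phi1 phir a b p C (mu_ n) mu
  (ltW a0) (ltW b0) p0 (ltW r0) erefl)).
apply: (@le_trans _ _ ((a * (2 * e))%:E + (a * (2 * e))%:E + (D * r)%:E)%E); last first.
  by rewrite -!EFinD lee_fin; lra.
apply: leeD.
  apply: leeD; rewrite EFinM lee_wpmul2l ?lee_fin ?(ltW a0)//.
    exact: (part_mass _ A erefl (far_n n) AC).
  exact: (part_mass _ B erefl far_mu BC).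
rewrite lee_fin /D.
have -> : b * m `^ p^-1 * d%:R * 2 * r = b * (m `^ p^-1 * (d%:R * (2 * r))) by ring.
have dr0 : 0 <= d%:R * (2 * r) by apply: mulr_ge0 => //; apply: mulr_ge0 => //; exact: ltW.
rewrite ler_wpM2l ?(ltW b0)// ler_wpM2r//.
by apply: ge0_ler_powR; rewrite ?nnegrE// invr_ge0 ltW.
Unshelve. all: by end_near. Qed.

Theorem theorem3 (R : realType) (d : nat) (a b p : R)
    (mu_ : nat -> MM R d) (mu : MM R d) :
  0 < a -> 0 < b -> 1 <= p ->
  ((fun n => Wab a b p (mu_ n) mu) @ \oo --> 0%E) <->
  (weak_cvg mu_ mu /\ tight mu_).
Proof.
move=> a0 b0 p1; split=> [W|[wmu tmu]]; last exact: Wab_cvg0.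
split; [exact: weak_cvg_of_Wab W|exact: tight_of_Wab W].
Qed.
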